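(* Let $n$ and $s$ be positive integers with $s<n$ and $\gcd(n,s+1)=1$, and let $F(X)=X^{2^n-2^s}$ over $\mathbb{F}_{2^n}$. Then for $a,b\in\mathbb{F}_{2^n}$, $$\nabla_F(a,b)=\begin{cases} 2^n & \text{if } ab=0 \text{ or } a=b,\\ 2^{\gcd(s,n)}-4 & \text{if } ab\neq 0,\ a\neq b,\ ab^{2^s}+a^{2^s}b=0 \text{ and } \gcd(s,n)>1,\\ 2^{\,n-s-\operatorname{rank}(E_1)}-4 & \text{if } ab\neq 0,\ a\neq b,\ ab^{2^s}+a^{2^s}b\neq 0,\ A\neq 1 \text{ and } \operatorname{rank}(E_1)\leq (n-s)-2,\\ 0 & \text{otherwise,} \end{cases}$$ where, for $ab\neq0$ and $a\neq b$, $A=\dfrac{ab^{2^{n-s}}+a^{2^{n-s}}b}{a^{2^{n-s}-2}(ab^2+a^2b)}$, $E_1=C_T\,C_T^{2}\,C_T^{2^2}\cdots C_T^{2^{n-1}}-I_{n-s}$, $C_T$ is the $(n-s)\times(n-s)$ matrix $$C_T=\begin{pmatrix} 0&0&\cdots&0&1+A\\ 1&0&\cdots&0&A\\ 0&1&\cdots&0&0\\ \cdots&\cdots&\cdots&\cdots&\cdots\\ 0&0&\cdots&1&0 \end{pmatrix},$$ $C_T^{2^i}$ denotes the matrix obtained from $C_T$ by applying the automorphism $X\mapsto X^{2^i}$ to each of its entries, and $I_k$ is the identity matrix of order $k$.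
   Context: For $F:\mathbb{F}_{2^n}\to\mathbb{F}_{2^n}$ and $a,b\in\mathbb{F}_{2^n}$, $\nabla_F(a,b)=\#\{X\in\mathbb{F}_{2^n}: F(X+a+b)+F(X+b)+F(X+a)+F(X)=0\}$. The notation $C_T^{2^i}$ (including $C_T^{2}$, the case $i=1$) is entrywise application of the $2^i$-power Frobenius, not a matrix power. The matrix $C_T$ has ones on the first subdiagonal, last column $(1+A,A,0,\dots,0)^{T}$, and zeros elsewhere (for $n-s=2$ it is $\begin{pmatrix}0&1+A\\1&A\end{pmatrix}$). Rank is over $\mathbb{F}_{2^n}$. *)

(* Defs.v *)
From mathcomp Require Import all_boot all_order all_algebra.

Set Implicit Arguments.
Unset Strict Implicit.
Unset Printing Implicit Defensive.

Import GRing.Theory.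
Local Open Scope ring_scope.

(* The (a, b) entry of the Feistel boomerang connectivity table of f. *)
Definition nabla (K : finFieldType) (f : K -> K) (a b : K) : nat :=
  #|[set X : K | f (X + a + b) + f (X + b) + f (X + a) + f X == 0]|.

Definition powF (K : fieldType) (n s : nat) (X : K) : K :=
  X ^+ (2 ^ n - 2 ^ s).

(* Of interest only for a, b nonzero and distinct, where the denominator is
   nonzero in characteristic 2. The exponent 2 ^ (n - s) - 2 does not truncate
   once s < n. *)
Definition coefA (K : fieldType) (n s : nat) (a b : K) : K :=
  (a * b ^+ (2 ^ (n - s)) + a ^+ (2 ^ (n - s)) * b)
    / (a ^+ (2 ^ (n - s) - 2) * (a * b ^+ 2 + a ^+ 2 * b)).

(* Meant for m >= 2; rows and columns are numbered from 0. The last column is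
   tested first, and the subdiagonal does not meet it. *)
Definition matCT (K : fieldType) (m : nat) (A : K) : 'M[K]_m :=
  \matrix_(i < m, j < m)
    (if j.+1 == m then
       (if i == 0%N :> nat then 1 + A else if i == 1%N :> nat then A else 0)
     else (i == j.+1 :> nat)%:R).

(* The product is ordered, the factor with exponent 2 ^ 0 being leftmost. *)
Definition matE1 (K : fieldType) (n m : nat) (A : K) : 'M[K]_m :=
  (\prod_(i < n) map_mx (fun x : K => x ^+ (2 ^ i)) (matCT m A)) - 1%:M.

(* Main.v *)
Require Import Defs.
From mathcomp Require Import all_boot all_order all_algebra.
From mathcomp Require Import all_field.
From mathcomp Require Import ring.

Import GRing.Theory.
Local Open Scope ring_scope.

(* Write q = 2^s and r = 2^(n-s). On K, F(X) = X / X^q, and by homogeneity the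
   count depends only on c = b/a, so take (a, b) = (1, c). Off the plane
   {0, 1, c, 1+c}, clearing denominators turns the equation into the vanishing
   of the determinant with rows (z, z^q, z^(2q)), z = 1, c, y, a linearized
   polynomial in y that also vanishes on the plane; on the plane the equation never holds, since
   gcd(n, s+1) = 1 forces c^(2q) <> c. Hence the count is the number of roots
   of that polynomial minus 4. If c^q = c the roots are the solutions of
   y^q = y. In general, raising to the power r gives
   y^r = A y^2 + (1 + A) y, whose roots are the first entries of the row vectors
   u with u^(2) = u C_T. By Galois descent these fixed points of a semilinear
   map form an F_2-structure of the K-space fixed by its n-th iterate, which is
   the left kernel of E_1. The side conditions A <> 1 and
   rank E_1 <= n - s - 2 then hold automatically. *)

(** * Elements fixed by iterated [p]-th powers *)

Lemma expfM_fixed (K : fieldType) (p i k : nat) (x : K) :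
  x ^+ (p ^ i) = x -> x ^+ (p ^ (i * k)) = x.
Proof.
move=> xi; elim: k => [|k IHk]; first by rewrite muln0 expn0 expr1.
by rewrite mulnS expnD exprM xi.
Qed.

(** Bezout gives [ki * i = kj * j + gcdn i j]. Both [p ^ (ki * i)] and [p ^ (kj * j)] fix [x], and
    the injective power [p ^ (kj * j)] can be cancelled. *)
Lemma expf_gcd_fixed (K : fieldType) (p i j : nat) (x : K) :
  injective (fun y : K => y ^+ p) ->
  x ^+ (p ^ i) = x -> x ^+ (p ^ j) = x -> x ^+ (p ^ gcdn i j) = x.
Proof.
move=> inj_p xi xj.
have inj_pX k : injective (fun y : K => y ^+ (p ^ k)).
  elim: k => [|k IHk] y z; first by rewrite /= !expr1.
  by rewrite /= expnS !exprM => /IHk/inj_p.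
case: (posnP i) => [->|i_gt0]; first by rewrite gcd0n.
case: (egcdnP j i_gt0) => ki kj def_ki _.
apply: (inj_pX (kj * j)%N); rewrite /= -exprM -expnD addnC -def_ki.
by rewrite mulnC expfM_fixed // mulnC expfM_fixed.
Qed.

(** * Frobenius powers on a field of [p ^ n] elements *)

Section FrobeniusFixedPoints.

Variables (K : finFieldType) (p n : nat).
Hypotheses (p_pr : prime p) (cardK : #|K| = (p ^ n)%N).

Let pcharK : p \in [pchar K] := card_finPcharP cardK p_pr.

Lemma expfD_frob (i : nat) (x y : K) :
  (x + y) ^+ (p ^ i) = x ^+ (p ^ i) + y ^+ (p ^ i).
Proof. by rewrite exprDn_pchar // pnatX (pnatE _ p_pr) pcharK. Qed.

Lemma expf_frob_inj : injective (fun x : K => x ^+ p).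
Proof.
move=> x y /=; rewrite -!(pFrobenius_autE pcharK); exact: fmorph_inj.
Qed.

Lemma expf_frob_card (x : K) : x ^+ (p ^ n) = x.
Proof. by rewrite -cardK expf_card. Qed.

Lemma dvdp_genPoly_frob (g k : nat) :
  ('X^(p ^ g) - 'X : {poly K}) %| 'X^(p ^ (g * k)) - 'X.
Proof.
have pcharP : p \in [pchar {poly K}] by rewrite pchar_poly.
elim: k => [|k IHk]; first by rewrite muln0 expn0 expr1 subrr dvdp0.
rewrite mulnS expnD [(p ^ g * _)%N]mulnC exprM.
have ->: ('X^(p ^ (g * k))) ^+ (p ^ g) - 'X
  = ('X^(p ^ (g * k)) - 'X) ^+ (p ^ g) + ('X^(p ^ g) - 'X) :> {poly K}.
  have pP : [pchar {poly K}].-nat (p ^ g)%N by rewrite pnatX (pnatE _ p_pr) pcharP.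
  have := exprDn_pchar ('X^(p ^ (g * k)) - 'X : {poly K}) 'X pP.
  by rewrite subrK => ->; rewrite -addrA.
rewrite dvdp_add // (dvdp_trans IHk) //.
by rewrite dvdp_exp // expn_gt0 prime_gt0.
Qed.

(** As [g] divides [n], ['X^(p ^ g) - 'X] divides ['X^(p ^ n) - 'X], the product of all ['X - x%:P].
    It therefore splits with distinct roots, as many as its degree. *)
Lemma card_frob_fixed (g : nat) :
  (0 < g)%N -> (g %| n)%N -> #|[set x : K | x ^+ (p ^ g) == x]| = (p ^ g)%N.
Proof.
move=> g_gt0 /dvdnP[k def_n].
have: ('X^(p ^ g) - 'X : {poly K}) %| \prod_x ('X - x%:P).
  by rewrite -finField_genPoly cardK def_n mulnC dvdp_genPoly_frob.
case/dvdp_prod_XsubC => s; set r := mask s _ => eqp_r.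
have pg_gt1 : (1 < p ^ g)%N by rewrite -(expn0 p) ltn_exp2l // prime_gt1.
have: size ('X^(p ^ g) - 'X : {poly K}) = (size r).+1.
  by rewrite (eqp_size eqp_r) size_prod_XsubC.
rewrite size_polyDl ?size_polyN ?size_polyX ?size_polyXn // => -[size_r].
have r_uniq : uniq r by rewrite mask_uniq // index_enum_uniq.
rewrite [RHS]size_r -(card_uniqP r_uniq); apply: eq_card => x.
have := eqp_root eqp_r x; rewrite root_prod_XsubC => <-.
by rewrite inE rootE !hornerE ?hornerXn subr_eq0.
Qed.

(** * Semilinear fixed points and Galois descent *)

Section Semilinear.

Variable m : nat.
Implicit Types (u w : 'rV[K]_m) (C : 'M[K]_m).

Local Notation fr i := (map_mx (fun x : K => x ^+ (p ^ i))).

Lemma map_frobS (h k i : nat) (M : 'M[K]_(h, k)) :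
  fr i.+1 M = map_mx (pFrobenius_aut pcharK) (fr i M).
Proof. by apply/matrixP => x y; rewrite !mxE pFrobenius_autE expnSr exprM. Qed.

Lemma map_frob0 (h k : nat) (M : 'M[K]_(h, k)) : fr 0 M = M.
Proof. by apply/matrixP => x y; rewrite !mxE expr1. Qed.

Lemma map_frob1 (h k : nat) (M : 'M[K]_(h, k)) :
  fr 1 M = map_mx (pFrobenius_aut pcharK) M.
Proof. by rewrite map_frobS map_frob0. Qed.

Lemma map_frobD (h k i j : nat) (M : 'M[K]_(h, k)) :
  fr i (fr j M) = fr (j + i) M.
Proof. by apply/matrixP => x y; rewrite !mxE expnD exprM. Qed.

Lemma map_frob_card (h k : nat) (M : 'M[K]_(h, k)) : fr n M = M.
Proof. by apply/matrixP => x y; rewrite !mxE expf_frob_card. Qed.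

Lemma map_frobM (h k l i : nat) (M : 'M[K]_(h, k)) (N : 'M[K]_(k, l)) :
  fr i (M *m N) = fr i M *m fr i N.
Proof.
elim: i => [|i IHi]; first by rewrite !map_frob0.
by rewrite !map_frobS IHi map_mxM.
Qed.

Lemma map_frob1Z (h k : nat) (c : K) (M : 'M[K]_(h, k)) :
  fr 1 (c *: M) = c ^+ p *: fr 1 M.
Proof. by apply/matrixP => x y; rewrite !mxE exprMn expn1. Qed.

(** At [k = n] the right side is [u] itself, which places the fixed points in the left kernel of the
    norm of [C] minus the identity. *)
Lemma frob_fixed_norm (C : 'M[K]_m) (u : 'rV[K]_m) (k : nat) :
  fr 1 u = u *m C -> u *m (\prod_(0 <= i < k) fr i C) = fr k u.
Proof.
move=> fix_u; elim: k => [|k IHk]; first by rewrite big_nil mulmx1 map_frob0.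
rewrite big_nat_recr //= -mulmxE mulmxA IHk -map_frobM -fix_u.
by rewrite map_frobD add1n.
Qed.

Lemma map_frob1_prod (C : 'M[K]_m) (j k : nat) :
  fr 1 (\prod_(j <= i < k) fr i C) = \prod_(j.+1 <= i < k.+1) fr i C.
Proof.
rewrite big_add1 /= map_frob1.
have fr_M : {morph map_mx (pFrobenius_aut pcharK) : X Y / (X : 'M[K]_m) * Y}.
  by move=> X Y; rewrite -mulmxE map_mxM.
rewrite (big_morph _ fr_M (map_mx1 _ _)).
by apply: eq_bigr => i _; rewrite -map_frobS.
Qed.

(* The Galois trace of [c *: w] for the semilinear map with fixed points
   [fr 1 u = u *m C]. *)
Lemma frob_trace_fixed (C : 'M[K]_m) (w : 'rV[K]_m) (c : K) :
  let f j := fr j w *m \prod_(j <= i < n) fr i C in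
  w *m (\prod_(0 <= i < n) fr i C) = w ->
  fr 1 (\sum_(0 <= j < n) c ^+ (p ^ j) *: f j)
    = (\sum_(0 <= j < n) c ^+ (p ^ j) *: f j) *m C.
Proof.
move=> f fix_w; pose g j := c ^+ (p ^ j) *: f j.
have g_n : g n = g 0%N.
  by rewrite /g /f big_geq // mulmx1 map_frob_card map_frob0 fix_w
     expf_frob_card expr1.
have gS j : (j < n)%N -> fr 1 (g j) = g j.+1 *m C.
  move=> lt_jn; rewrite /g map_frob1Z -exprM -expnSr -scalemxAl; congr (_ *: _).
  (* Frobenius shifts the factors [j..n-1] to [j+1..n], and the extra last factor [fr n C] is [C]
     again. *)
  rewrite /f map_frobM map_frobD addn1 map_frob1_prod big_nat_recr //=.
  by rewrite -mulmxE map_frob_card mulmxA.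
(* Since [g n = g 0], the semilinear map only permutes the terms of the trace cyclically. *)
have shift : \sum_(0 <= j < n) g j = \sum_(0 <= j < n) g j.+1.
  have [->|n_gt0] := posnP n; first by rewrite !big_nil.
  apply: (addIr (g n)); rewrite -big_nat_recr //= big_nat_recl //.
  by rewrite g_n addrC.
rewrite -/(g _) shift mulmx_suml -(eq_big_nat _ _ (fun j H => gS j (andP H).2)).
rewrite -shift map_frob1 raddf_sum /=.
by apply: eq_bigr => j _; rewrite -map_frob1.
Qed.

(** The sum is a polynomial in [c] of degree at most [p ^ (n - 1)] with [p ^ n] roots, hence zero;
    [f 0] is its coefficient of degree 1. This recovers a vector from its traces. *)
Lemma frob_poly_eq0 (f : nat -> K) : (0 < n)%N ->
  (forall c : K, \sum_(0 <= j < n) c ^+ (p ^ j) * f j = 0) -> f 0%N = 0.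
Proof.
move=> n_gt0 f0; pose P := \sum_(0 <= j < n) f j *: 'X^(p ^ j) : {poly K}.
have P_0 : P = 0.
  apply: (@roots_geq_poly_eq0 _ P (enum K)); last 1 first.
  - rewrite -cardE cardK; apply: leq_trans (size_sum _ _ _) _.
    apply/bigmax_leqP_seq => j; rewrite mem_index_iota => /andP[_ lt_jn] _.
    by rewrite (leq_trans (size_scale_leq _ _)) // size_polyXn ltn_exp2l ?prime_gt1.
  - apply/allP => c _; rewrite rootE /P horner_sum.
    under eq_bigr do rewrite hornerZ hornerXn mulrC.
    by rewrite f0.
  - exact: enum_uniq.
have: P`_1 = 0 by rewrite P_0 coef0.
rewrite /P big_ltn // coefD coefZ coefXn eqxx mulr1 coef_sum big1_seq ?addr0 //.
move=> j /=; rewrite mem_index_iota => /andP[j_gt0 _].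
by rewrite coefZ coefXn ltn_eqF ?mulr0 // -(expn0 p) ltn_exp2l ?prime_gt1.
Qed.

Lemma card_row_frob_fixed (r : nat) : (0 < n)%N ->
  #|[set c : 'rV[K]_r | fr 1 c == c]| = (p ^ r)%N.
Proof.
move=> n_gt0; pose Fp := [set x : K | x ^+ (p ^ 1) == x].
have -> : (p ^ r = #|[set f : {ffun 'I_r -> K} | f \in ffun_on (mem Fp)]|)%N.
  by rewrite cardsE card_ffun_on card_ord card_frob_fixed ?dvd1n.
have inj_row : injective (fun f : {ffun 'I_r -> K} => \row_j f j).
  by move=> f g /rowP eq_fg; apply/ffunP => j; have := eq_fg j; rewrite !mxE.
rewrite -(card_imset _ inj_row); apply: eq_card => c; rewrite inE.
apply/eqP/imsetP => [/rowP fix_c | [f]].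
  exists [ffun j => c 0 j]; last by apply/rowP => j; rewrite !mxE ffunE.
  rewrite inE; apply/ffun_onP => j; rewrite ffunE inE.
  by have := fix_c j; rewrite mxE => ->.
rewrite inE => /ffun_onP fix_f ->; apply/rowP => j; rewrite !mxE.
by apply/eqP; have := fix_f j; rewrite inE.
Qed.

(* Galois descent: the fixed points of the semilinear map span, over [K], the
   space fixed by its [n]-th iterate. *)
Lemma card_frob_mx_fixed (C : 'M[K]_m) : (0 < n)%N ->
  #|[set u : 'rV[K]_m | fr 1 u == u *m C]|
    = (p ^ (m - \rank (\prod_(i < n) fr i C - 1%:M)%R))%N.
Proof.
move=> n_gt0; set U := [set u | _].
rewrite -(big_mkord xpredT (fun i => fr i C)); set N := \prod_(_ <= _ < _) _.
(* The rows of [X] are all the fixed points, so its row space is their [K]-span. *)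
pose X : 'M[K]_(#|U|, m) := \matrix_i enum_val i.
have UX u : u \in U -> (u <= X)%MS.
  move=> Uu; rewrite (_ : u = row (enum_rank_in Uu u) X) ?row_sub //.
  by rewrite rowK enum_rankK_in.
have kerX : (X :=: kermx (N - 1%:M))%MS.
  apply/eqmxP/andP; split.
    apply/row_subP => i; rewrite rowK; apply/sub_kermxP.
    have := enum_valP i; rewrite inE => /eqP fix_u.
    by rewrite mulmxBr mulmx1 (frob_fixed_norm C _ n fix_u) map_frob_card subrr.
  apply/row_subP => k; set w := row k _.
  have fix_w : w *m N = w.
    apply/eqP; rewrite -subr_eq0 -[X in _ - X]mulmx1 -mulmxBr.
    by apply/eqP/sub_kermxP; rewrite row_sub.
  (* The traces of all [c *: w] are fixed points, hence killed by [cokermx X]; the term of index 0,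
     which is [w], is then killed too. *)
  rewrite submxE; apply/eqP/rowP => l; rewrite [RHS]mxE.
  pose f j := fr j w *m \prod_(j <= i < n) fr i C.
  have f0 : f 0%N = w by rewrite /f map_frob0.
  rewrite -f0; apply: (frob_poly_eq0 (fun j => (f j *m cokermx X) 0 l)) => // c.
  have: \sum_(0 <= j < n) c ^+ (p ^ j) *: f j \in U.
    by rewrite inE; apply/eqP/frob_trace_fixed.
  move/UX; rewrite submxE mulmx_suml => /eqP/rowP/(_ l).
  rewrite summxE [RHS]mxE => {2}<-; apply: eq_bigr => j _.
  by rewrite -scalemxAl [RHS]mxE.
(* [B] is a [K]-basis of the span made of fixed points; a combination of its rows is fixed exactly
   when its coefficients lie in the prime field. *)
rewrite -mxrank_ker -kerX; pose B := rowsub (maxrankfun X) X.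
have B_free : row_free B := maxrowsub_free X.
have BX : (B :=: X)%MS := eq_maxrowsub X.
have frB : fr 1 B = B *m C.
  apply/row_matrixP => k; rewrite row_mul -map_row row_rowsub rowK.
  by have := enum_valP (maxrankfun X k); rewrite inE => /eqP.
rewrite -(card_row_frob_fixed (\rank X)) //.
rewrite -(card_imset _ (row_free_inj B_free)); apply: eq_card => u.
have fixB (c : 'rV_(\rank X)) : (fr 1 (c *m B) == c *m B *m C) = (fr 1 c == c).
  have frB_free : row_free (fr 1 B) by rewrite map_frob1 row_free_map.
  by rewrite map_frobM -mulmxA -frB; exact: (inj_eq (row_free_inj frB_free)).
apply/idP/imsetP => [Uu | [c]]; last by rewrite !inE -fixB => /eqP fix_c ->; apply/eqP.
have: (u <= B)%MS by rewrite BX UX.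
case/submxP => c def_u; exists c => //.
by rewrite inE -fixB -def_u; move: Uu; rewrite inE.
Qed.

End Semilinear.

End FrobeniusFixedPoints.

(** The subdiagonal of ones forces [u = (y, y^2, y^4, ...)], and the last column then imposes the
    equation on [y]. *)
Lemma card_companion_fixed (K : finFieldType) (m : nat) (A : K) : (1 < m)%N ->
  #|[set u : 'rV[K]_m | map_mx (fun x : K => x ^+ (2 ^ 1)) u == u *m matCT m A]|
    = #|[set y : K | y ^+ (2 ^ m) == A * y ^+ 2 + (1 + A) * y]|.
Proof.
case: m => [|[|m]] // _; set U := [set u | _].
have mul_lt (u : 'rV[K]_m.+2) (j : 'I_m.+2) :
    (j.+1 < m.+2)%N -> (u *m matCT m.+2 A) 0 j = u 0 (inord j.+1).
  move=> lt_j; rewrite mxE (bigD1 (inord j.+1)) //= big1 => [|i ne_i].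
    by rewrite mxE ltn_eqF // inordK // eqxx mulr1 addr0.
  rewrite mxE ltn_eqF //; case: eqP => [eq_i|]; last by rewrite mulr0.
  by case/eqP: ne_i; apply: val_inj; rewrite /= inordK.
have mul_last (u : 'rV[K]_m.+2) :
    (u *m matCT m.+2 A) 0 ord_max = A * u 0 (inord 1) + (1 + A) * u 0 0.
  rewrite mxE 2!big_ord_recl big1 => [|i _]; last by rewrite mxE /= eqxx mulr0.
  rewrite !mxE /= eqxx addr0 addrC mulrC; congr (_ * u 0 _ + _).
    by apply: val_inj; rewrite /= inordK.
  exact: mulrC.
have powU u : u \in U -> forall j : 'I_m.+2, u 0 j = (u 0 0) ^+ (2 ^ j).
  rewrite inE => /eqP/rowP fix_u [j lt_j]; elim: j lt_j => [|j IHj] lt_j.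
    by rewrite expn0 expr1; congr (u 0 _); apply: val_inj.
  have lt_j' := ltnW lt_j; have := fix_u (Ordinal lt_j').
  rewrite mul_lt // mxE (IHj lt_j') -exprM -expnD addn1 /= => ->.
  by congr (u 0 _); apply: val_inj; rewrite /= inordK.
rewrite -(card_in_imset (f := fun u : 'rV[K]_m.+2 => u 0 0)); last first.
  by move=> u v Uu Uv /= eq_uv; apply/rowP => j; rewrite (powU u) // (powU v) // eq_uv.
apply: eq_card => y; rewrite inE; apply/imsetP/eqP => [[u Uu ->] | eq_y].
  have := Uu; rewrite inE => /eqP/rowP/(_ ord_max).
  rewrite mul_last mxE (powU _ Uu ord_max) (powU _ Uu (inord 1)) inordK //=.
  by rewrite -exprM -expnD addn1 expn1.
exists (\row_j y ^+ (2 ^ j)); last by rewrite mxE expr1.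
rewrite inE; apply/eqP/rowP => j; rewrite !mxE -exprM -expnD addn1.
have [lt_j | ge_j] := ltnP j.+1 m.+2.
  have := mul_lt (\row_j y ^+ (2 ^ j)) j lt_j.
  by rewrite mxE => ->; rewrite mxE inordK.
have ->: j = ord_max.
  by apply: val_inj => /=; apply/eqP; rewrite eqn_leq -ltnS ltn_ord.
have := mul_last (\row_j y ^+ (2 ^ j)).
by rewrite mxE => ->; rewrite !mxE inordK //= expr1 eq_y.
Qed.

(** * The power map over the field of [2 ^ n] elements *)

Section CharacteristicTwo.

Variables (K : finFieldType) (n s : nat).
Hypotheses (s_gt0 : (0 < s)%N) (s_lt_n : (s < n)%N).
Hypotheses (co_n_s1 : gcdn n s.+1 = 1%N) (cardK : #|K| = (2 ^ n)%N).

Local Notation q := (2 ^ s)%N.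
Local Notation r := (2 ^ (n - s))%N.

Let expfD := expfD_frob K 2 n isT cardK.

Let two_eq0 : 2%:R = 0 :> K.
Proof. exact: pcharf0 (card_finPcharP cardK isT). Qed.

(** Turns an identity modulo 2 into one over the integers, within reach of [ring]; [z] is half of
    the difference of the sides. *)
Let eq_mod2 (z x y : K) : x = y + 2%:R * z -> x = y.
Proof. by rewrite two_eq0 mul0r addr0. Qed.

Let addrr_char2 (x : K) : x + x = 0.
Proof. by ring : two_eq0. Qed.

Let addr_eq0_char2 (x y : K) : (x + y == 0) = (x == y).
Proof. by rewrite -(inj_eq (addIr y)) -addrA addrr_char2 addr0 add0r. Qed.

(** By coprimality, [c] is already fixed by squaring. *)
Lemma expf_frob_coprime (c : K) : c ^+ (2 ^ s.+1) = c -> (c == 0) || (c == 1).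
Proof.
move=> fix_c.
have := expf_gcd_fixed K 2 n s.+1 c (expf_frob_inj K 2 n isT cardK)
  (expf_frob_card K 2 n cardK c) fix_c.
by rewrite co_n_s1 expn1 => /eqP; rewrite -subr_eq0 -[X in _ - X]mulr1 -mulrBr
  mulf_eq0 subr_eq0.
Qed.

Lemma powFE (x : K) : powF n s x = x / x ^+ q.
Proof.
have [->|x_neq0] := eqVneq x 0.
  by rewrite mul0r /powF expr0n subn_eq0 leqNgt ltn_exp2l // s_lt_n.
apply: (canRL (mulfK _)); first by rewrite expf_neq0.
rewrite /powF -exprD subnK; first exact: (expf_frob_card K 2 n cardK).
by rewrite leq_exp2l // ltnW.
Qed.

Lemma nabla_powF_scale (a b : K) :
  a != 0 -> nabla (powF n s) a b = nabla (powF n s) 1 (b / a).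
Proof.
move=> a_neq0; rewrite /nabla -[RHS](card_imset _ (mulfI a_neq0)).
have scale y : powF n s (a * y) = powF n s a * powF n s y by rewrite /powF exprMn.
have eqF y : (powF n s (a * y + a + b) + powF n s (a * y + b)
    + powF n s (a * y + a) + powF n s (a * y) == 0) =
  (powF n s (y + 1 + b / a) + powF n s (y + b / a) + powF n s (y + 1)
    + powF n s y == 0).
  have ->: a * y + a + b = a * (y + 1 + b / a) by field.
  have ->: a * y + b = a * (y + b / a) by field.
  have ->: a * y + a = a * (y + 1) by ring.
  by rewrite !scale -!mulrDr mulf_eq0 [powF n s a == 0]expf_eq0 (negPf a_neq0) andbF.
apply: eq_card => X; have [y ->]: exists y, X = a * y.
  by exists (a^-1 * X); rewrite mulVKf.
by rewrite (mem_imset _ _ (mulfI a_neq0)) !inE eqF.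
Qed.

(** * The normalized case [(a, b) = (1, c)] *)

Section Normalized.

Variable c : K.
Hypotheses (c_neq0 : c != 0) (c_neq1 : c != 1).

Let plane := [set y in [:: 0; 1; c; 1 + c]].

(* The 3 x 3 determinant with rows [(z, z ^+ q, z ^+ (2 * q))] for [z] equal to
   [1], [c] and [y]; signs do not matter in characteristic 2. *)
Definition frob_det (y : K) : K :=
  (c ^+ q + c) * (y ^+ q) ^+ 2 + ((c ^+ q) ^+ 2 + c) * y ^+ q
    + ((c ^+ q) ^+ 2 + c ^+ q) * y.

Let expq_eq0 (x : K) : (x ^+ q == 0) = (x == 0).
Proof. by rewrite expf_eq0 expn_gt0. Qed.

Let c1_neq0 : 1 + c != 0.
Proof. by rewrite addr_eq0_char2 eq_sym. Qed.

Lemma card_plane : #|plane| = 4%N.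
Proof.
suff: uniq [:: 0; 1; c; 1 + c].
  move/card_uniqP => card_s; rewrite -[RHS]card_s.
  by apply: eq_card => x; rewrite inE.
have c_neq1c : c != 1 + c.
  rewrite -addr_eq0_char2; have ->: c + (1 + c) = 1 by ring : two_eq0.
  exact: oner_neq0.
have one_neq1c : 1 != 1 + c.
  by rewrite -addr_eq0_char2; have ->: 1 + (1 + c) = c by ring : two_eq0.
rewrite /= !inE !negb_or c_neq1c one_neq1c ![_ == c]eq_sym c_neq0 c_neq1.
by rewrite ![0 == _]eq_sym oner_neq0 c1_neq0.
Qed.

Lemma frob_det_plane : plane \subset [set y | frob_det y == 0].
Proof.
apply/subsetP => y; rewrite !inE /frob_det => /or4P[] /eqP->.
- by rewrite expr0n expn_eq0 /= expr0n !mulr0 !addr0.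
- by rewrite !expr1n; apply/eqP; ring : two_eq0.
- by apply/eqP; ring : two_eq0.
- rewrite expfD expr1n; apply/eqP; set C := c ^+ q.
  by apply: (eq_mod2 (C + 2 * C ^+ 2 + C ^+ 3 + c + 2 * c * C + c * C ^+ 2)); ring.
Qed.

Definition second_diff (y : K) : K :=
  powF n s (y + 1 + c) + powF n s (y + c) + powF n s (y + 1) + powF n s y.

Lemma second_diff_off_plane (y : K) :
  y \notin plane -> (second_diff y == 0) = (frob_det y == 0).
Proof.
rewrite !inE !negb_or => /and4P[y0 y1 yc y1c].
have y1' : y + 1 != 0 by rewrite addr_eq0_char2.
have yc' : y + c != 0 by rewrite addr_eq0_char2.
have y1c' : y + 1 + c != 0 by rewrite -addrA addr_eq0_char2.
have := expq_eq0 y; have := expq_eq0 (y + 1); have := expq_eq0 (y + c).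
have := expq_eq0 (y + 1 + c).
rewrite /second_diff !powFE /frob_det !expfD expr1n.
rewrite (negPf y0) (negPf y1') (negPf yc') (negPf y1c').
set Y := y ^+ q; set C := c ^+ q => Y1C0 YC0 Y10 Y0.
have -> : (y + 1 + c) / (Y + 1 + C) + (y + c) / (Y + C) + (y + 1) / (Y + 1) + y / Y
  = ((y + 1 + c) * (Y * (Y + 1) * (Y + C)) + (y + c) * (Y * (Y + 1) * (Y + 1 + C))
     + (y + 1) * (Y * (Y + C) * (Y + 1 + C)) + y * ((Y + 1) * (Y + C) * (Y + 1 + C)))
    / (Y * (Y + 1) * (Y + C) * (Y + 1 + C)).
  by field; rewrite Y1C0 YC0 Y10 Y0.
have -> : (y + 1 + c) * (Y * (Y + 1) * (Y + C)) + (y + c) * (Y * (Y + 1) * (Y + 1 + C))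
    + (y + 1) * (Y * (Y + C) * (Y + 1 + C)) + y * ((Y + 1) * (Y + C) * (Y + 1 + C))
  = (C + c) * Y ^+ 2 + (C ^+ 2 + c) * Y + (C ^+ 2 + C) * y.
  apply: (eq_mod2 (2 * Y ^+ 3 * y + 3 * C * Y ^+ 2 * y + 3 * Y ^+ 2 * y
    + 3 * C * Y * y + C ^+ 2 * Y * y + Y * y
    + (1 + c) * (Y ^+ 3 + C * Y ^+ 2 + Y ^+ 2 + C * Y))).
  by ring.
by rewrite mulf_eq0 invr_eq0 !mulf_eq0 Y1C0 YC0 Y10 Y0 !orbF.
Qed.

(** The four arguments run over the plane whichever of its points [y] is, so a single value,
    [diff0], has to be nonzero. *)
Lemma second_diff_plane (y : K) : y \in plane -> second_diff y != 0.
Proof.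
have diff0 : powF n s (1 + c) + powF n s c + powF n s 1 + powF n s 0 != 0.
  have := expq_eq0 (1 + c); have := expq_eq0 c.
  rewrite !powFE expfD !expr1n (negPf c_neq0) (negPf c1_neq0) mul0r addr0.
  move=> C0 C10.
  (* The numerator vanishes only if [c] is fixed by the power [2 ^ s.+1], that is, if [c] is 0 or
     1. *)
  have -> : (1 + c) / (1 + c ^+ q) + c / c ^+ q + 1 / 1
    = (c + c ^+ (2 ^ s.+1)) / (c ^+ q * (1 + c ^+ q)).
    rewrite expnSr exprM; set C := c ^+ q in C0 C10 *.
    have -> : c + C ^+ 2 = (1 + c) * C + c * (1 + C) + C * (1 + C) by ring : two_eq0.
    by field; rewrite C0 C10 oner_neq0.
  rewrite mulf_eq0 invr_eq0 mulf_eq0 C0 C10 !orbF addr_eq0_char2.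
  apply/eqP => /esym/expf_frob_coprime.
  by rewrite (negPf c_neq0) (negPf c_neq1).
rewrite !inE /second_diff => /or4P[] /eqP->.
- by rewrite !add0r.
- rewrite addrr_char2 add0r; apply: contraNneq diff0 => diff0.
  by rewrite -[X in _ == X]diff0; apply/eqP; ring.
- have ->: c + 1 + c = 1 by ring : two_eq0.
  rewrite addrr_char2 [c + 1]addrC; apply: contraNneq diff0 => diff0.
  by rewrite -[X in _ == X]diff0; apply/eqP; ring.
- have ->: 1 + c + 1 + c = 0 by ring : two_eq0.
  have ->: 1 + c + c = 1 by ring : two_eq0.
  have ->: 1 + c + 1 = c by ring : two_eq0.
  apply: contraNneq diff0 => diff0.
  by rewrite -[X in _ == X]diff0; apply/eqP; ring.
Qed.

Lemma nabla_powF_frob_det :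
  nabla (powF n s) 1 c = (#|[set y | frob_det y == 0%R]| - 4)%N.
Proof.
rewrite -card_plane -cardsDS ?frob_det_plane //; apply: eq_card => y.
rewrite [LHS]inE in_setD [y \in [set _ | _]]inE -/(second_diff y).
by have [/second_diff_plane/negPf -> | /second_diff_off_plane ->] := boolP (y \in plane).
Qed.

(** Source of the side conditions on the gcd and on the rank: a root count that is a power of 2 has
    exponent at least 2. *)
Lemma leq4_card_frob_det : (4 <= #|[set y | frob_det y == 0%R]|)%N.
Proof. by rewrite -card_plane subset_leq_card ?frob_det_plane. Qed.

(** The determinant becomes [c * (1 + c) * (y ^+ q + y)], so its roots are the elements fixed by the
    [s]-th Frobenius power, hence by the one of index [gcdn s n]. *)
Lemma card_frob_det_degenerate : c ^+ q + c = 0 ->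
  #|[set y | frob_det y == 0%R]| = (2 ^ gcdn s n)%N.
Proof.
move/eqP; rewrite addr_eq0_char2 => /eqP fix_c.
have g_gt0 : (0 < gcdn s n)%N by rewrite gcdn_gt0 s_gt0.
rewrite -(card_frob_fixed K 2 n isT cardK _ g_gt0 (dvdn_gcdr s n)).
apply: eq_card => y; rewrite !inE /frob_det fix_c.
have -> : (c + c) * (y ^+ q) ^+ 2 + (c ^+ 2 + c) * y ^+ q + (c ^+ 2 + c) * y
  = c * (1 + c) * (y ^+ q + y) by ring : two_eq0.
rewrite !mulf_eq0 (negPf c_neq0) (negPf c1_neq0) addr_eq0_char2 /=.
apply/eqP/eqP => [fix_y | fix_y].
  exact: (expf_gcd_fixed K 2 s n y (expf_frob_inj K 2 n isT cardK) fix_y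
    (expf_frob_card K 2 n cardK y)).
by have /dvdnP[k {1}->] := dvdn_gcdl s n; rewrite mulnC expfM_fixed.
Qed.

Lemma degenerate_gcd_gt1 : c ^+ q + c = 0 -> (1 < gcdn s n)%N.
Proof.
by move/card_frob_det_degenerate => card_c; have := leq4_card_frob_det;
  rewrite card_c -[4%N]/(2 ^ 2)%N leq_exp2l.
Qed.

Let A := (c ^+ r + c) / (c ^+ 2 + c).

Lemma sqr_add_neq0 : c ^+ 2 + c != 0.
Proof. by rewrite -[X in _ + X]mulr1 -mulrDr mulf_neq0 // addrC. Qed.

(** [A = 1] would mean [c ^+ r = c ^+ 2]; the power [q] turns this into [c = c ^+ (2 * q)], which
    coprimality excludes. *)
Lemma coefA_neq1 : A != 1.
Proof.
apply/eqP => A1; have : c ^+ r = c ^+ 2.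
  by apply: (addIr c); rewrite -[LHS](divfK sqr_add_neq0) -/A A1 mul1r.
move/(congr1 (fun x => x ^+ q)) => /=.
rewrite -[LHS]exprM -[RHS]exprM -expnD subnK; last exact: ltnW.
rewrite (expf_frob_card K 2 n cardK) -expnS => /esym/expf_frob_coprime.
by rewrite (negPf c_neq0) (negPf c_neq1).
Qed.

Lemma card_frob_det_generic :
  #|[set y | frob_det y == 0%R]|
    = (2 ^ (n - s - \rank (matE1 n (n - s) A)))%N.
Proof.
have n_gt0 : (0 < n)%N by apply: leq_trans s_lt_n.
(* If [n = s + 1], then [gcdn n s.+1 = n], so [n = 1] and [s = 0]. *)
have m_gt1 : (1 < n - s)%N.
  rewrite ltn_subRL addn1 ltn_neqAle s_lt_n andbT; apply: contraTneq s_gt0 => eq_n.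
  by have := co_n_s1; rewrite eq_n gcdnn => n1; move: eq_n; rewrite n1 => -[->].
rewrite -(card_frob_mx_fixed K 2 n isT cardK (n - s) (matCT (n - s) A) n_gt0).
rewrite card_companion_fixed //; apply: eq_card => y; rewrite !inE.
have expqr (x : K) : (x ^+ q) ^+ r = x.
  rewrite -exprM -expnD subnKC; last exact: ltnW.
  exact: (expf_frob_card K 2 n cardK).
have r_gt0 : (0 < r)%N by rewrite expn_gt0.
(* The power [r] undoes the power [q], leaving [y] only to the exponents 1, 2 and [r]. *)
have <- : (frob_det y ^+ r == 0) = (frob_det y == 0).
  by rewrite expf_eq0 r_gt0.
have -> : frob_det y ^+ r
  = (c + c ^+ r) * y ^+ 2 + (c ^+ 2 + c ^+ r) * y + (c ^+ 2 + c) * y ^+ r.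
  rewrite /frob_det !expfD !exprMn !expfD.
  by rewrite ![(_ ^+ 2) ^+ r]exprAC !expqr.
have -> : (c + c ^+ r) * y ^+ 2 + (c ^+ 2 + c ^+ r) * y + (c ^+ 2 + c) * y ^+ r
  = (c ^+ 2 + c) * (y ^+ r + (A * y ^+ 2 + (1 + A) * y)).
  by rewrite /A; field : two_eq0; exact: sqr_add_neq0.
by rewrite mulf_eq0 (negPf sqr_add_neq0) addr_eq0_char2.
Qed.

End Normalized.

End CharacteristicTwo.

Theorem theorem4p5 (n s : nat) (K : finFieldType) (a b : K)
  (n_gt0 : (0 < n)%N) (s_gt0 : (0 < s)%N) (s_lt_n : (s < n)%N)
  (co_n_s1 : gcdn n s.+1 = 1%N) (cardK : #|K| = (2 ^ n)%N) :
  let A := coefA n s a b in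
  let E1 := matE1 n (n - s) A in
  nabla (powF n s) a b =
    if (a * b == 0) || (a == b) then (2 ^ n)%N
    else if [&& a * b != 0, a != b,
                a * b ^+ (2 ^ s) + a ^+ (2 ^ s) * b == 0
              & (1 < gcdn s n)%N]
    then (2 ^ gcdn s n - 4)%N
    else if [&& a * b != 0, a != b,
                a * b ^+ (2 ^ s) + a ^+ (2 ^ s) * b != 0,
                A != 1
              & (\rank E1 <= n - s - 2)%N]
    then (2 ^ (n - s - \rank E1) - 4)%N
    else 0%N.
Proof.
move=> A E1; have two_eq0 : 2%:R = 0 :> K := pcharf0 (card_finPcharP cardK isT).
have [|] := boolP ((a * b == 0) || (a == b)).
  rewrite mulf_eq0 -cardK => ab; apply: eq_card => X; rewrite !inE.
  case/orP: ab => [/orP[] /eqP-> | /eqP->]; rewrite ?addr0.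
  - by apply/eqP; ring : two_eq0.
  - by apply/eqP; ring : two_eq0.
  - have ->: X + b + b = X by ring : two_eq0.
    by apply/eqP; ring : two_eq0.
rewrite negb_or => /andP[ab_neq0 neq_ab]; rewrite ab_neq0 neq_ab /=.
have /andP[a_neq0 b_neq0] : (a != 0) && (b != 0) by rewrite -negb_or -mulf_eq0.
pose c := b / a.
have c_neq0 : c != 0 by rewrite mulf_neq0 ?invr_eq0.
have c_neq1 : c != 1.
  by apply: contraNneq neq_ab => c1; rewrite -[b](divfK a_neq0) -/c c1 mul1r.
have def_b : b = a * c by rewrite mulrC divfK.
have -> : (a * b ^+ (2 ^ s) + a ^+ (2 ^ s) * b == 0) = (c ^+ (2 ^ s) + c == 0).
  have -> : a * b ^+ (2 ^ s) + a ^+ (2 ^ s) * b = a ^+ (2 ^ s) * a * (c ^+ (2 ^ s) + c).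
    by rewrite def_b exprMn; ring.
  by rewrite !mulf_eq0 expf_eq0 (negPf a_neq0) andbF.
have sqr_c := sqr_add_neq0 K n cardK c c_neq0 c_neq1.
have def_A : A = (c ^+ (2 ^ (n - s)) + c) / (c ^+ 2 + c).
  (* This makes the natural-number subtraction in the exponent of [coefA] exact. *)
  have le2r : (2 <= 2 ^ (n - s))%N by rewrite -{1}(expn1 2) leq_exp2l // subn_gt0.
  have def_ar : a ^+ (2 ^ (n - s)) = a ^+ (2 ^ (n - s) - 2) * a ^+ 2.
    by rewrite -exprD subnK.
  rewrite /A /coefA def_b exprMn def_ar.
  have := expf_neq0 (2 ^ (n - s) - 2) a_neq0; set e := a ^+ _ => e_neq0.
  field; rewrite sqr_c e_neq0 andbT /=.
  have -> : a * (a * c) ^+ 2 + a ^+ 2 * (a * c) = a ^+ 3 * (c ^+ 2 + c) by ring.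
  by rewrite mulf_neq0 // expf_neq0.
have leq4 := leq4_card_frob_det K n s cardK c c_neq0 c_neq1.
rewrite (nabla_powF_scale _ _ _ _ _ a_neq0) -/c.
rewrite (nabla_powF_frob_det K n s s_lt_n co_n_s1 cardK c c_neq0 c_neq1).
have [c_deg | _] /= := eqVneq.
  rewrite (degenerate_gcd_gt1 K n s s_gt0 cardK c c_neq0 c_neq1 c_deg).
  by rewrite (card_frob_det_degenerate K n s s_gt0 cardK c c_neq0 c_neq1 c_deg).
rewrite def_A (coefA_neq1 K n s s_lt_n co_n_s1 cardK c c_neq0 c_neq1) /=.
have card_gen := card_frob_det_generic K n s s_gt0 s_lt_n co_n_s1 cardK c c_neq0 c_neq1.
rewrite card_gen -def_A -/E1 in leq4 *.
(* The four roots in the plane give [2 ^ 2 <= 2 ^ (n - s - \rank E1)]. *)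
have -> // : (\rank E1 <= n - s - 2)%N.
move: leq4; rewrite -[4%N]/(2 ^ 2)%N leq_exp2l // ltn_subRL addn1 => lt_rank.
by rewrite leq_subRL ?add2n // (leq_trans _ lt_rank).
Qed.
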